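(* Let $\kappa>1$ be real and let $\mu=\frac{\kappa-1}{\kappa+1}\in(0,1)$. The function $$\bar r_{c_{23}^*}(c_1)=\frac12\left|\mu(1+c_1)+\sqrt{\mu^2(1+c_1)^2-4c_1}\right|,\qquad c_1\in\mathbb R,$$ is minimized at $$c_1^*=\left(\frac{\sqrt\kappa-1}{\sqrt\kappa+1}\right)^2 .$$
   Context: The square root of a negative number is taken to be imaginary and $|\cdot|$ denotes the complex modulus. In the source, $\kappa=a_\alpha^{\max}/a_\alpha^{\min}$ is the condition number of a matrix with real positive eigenvalues, and $\bar r_{c_{23}^*}(c_1)$ is the convergence factor of a two-step iteration as a function of the parameter $c_1$ after the other parameter $c_{23}$ has been chosen optimally. *)

(* Defs.v *)
From mathcomp Require Import all_boot all_order all_algebra.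
From mathcomp Require Import reals.
From mathcomp Require Import complex.

Set Implicit Arguments.
Unset Strict Implicit.
Unset Printing Implicit Defensive.

Import Order.TTheory GRing.Theory Num.Theory.

Local Open Scope ring_scope.
Local Open Scope complex_scope.

Definition mu (R : realType) (kappa : R) : R := (kappa - 1) / (kappa + 1).

(* [sqrtc] is the principal complex square root, so a negative radicand gives
   an imaginary number, whereas [Num.sqrt] would give 0. [normc] is the complex
   modulus with values in [R]; the generic norm on [R[i]] has values in [R[i]]. *)
Definition rbar (R : realType) (kappa c1 : R) : R :=
  1 / 2 * ComplexField.Normc.normc
            ((mu kappa * (1 + c1))%:C
             + sqrtc (mu kappa ^+ 2 * (1 + c1) ^+ 2 - 4 * c1)%:C).

Definition c1star (R : realType) (kappa : R) : R :=
  ((Num.sqrt kappa - 1) / (Num.sqrt kappa + 1)) ^+ 2.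

Definition is_global_minimizer (R : realType) (f : R -> R) (x0 : R) : Prop :=
  forall x : R, f x0 <= f x.

(* Main.v *)
Require Import Defs.
From mathcomp Require Import all_boot all_order all_algebra.
From mathcomp Require Import reals.
From mathcomp Require Import complex ring lra.

Import Order.TTheory GRing.Theory Num.Theory.

Local Open Scope ring_scope.

(* With s = sqrt kappa and q = (s - 1) / (s + 1) one has mu = 2q / (1 + q^2), and
   the value at c1* = q^2 is q because the radicand vanishes there. Put
   m = mu (1 + c). If the radicand m^2 - 4c is negative, the modulus is sqrt c and
   negativity forces q^2 < c. Otherwise the function is |r| for the larger
   root r of X^2 - m X + c; if |r| < q, eliminating c from m <= 2r gives
   mu <= 2r / (1 + r^2), contradicting monotonicity of x -> 2x / (1 + x^2) on
   (-1, 1). *)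

Lemma normc_real_add_sqrtc_ge0 (R : rcfType) (m d : R) : 0 <= d ->
  ComplexField.Normc.normc (m%:C + sqrtc d%:C)%C = `|m + Num.sqrt d|.
Proof.
move=> d_ge0; rewrite sqrtc_sqrtr ?lecR //.
by rewrite /= addr0 expr0n addr0 sqrtr_sqr.
Qed.

(** Here [sqrtc] is purely imaginary with square [d], so the squared modulus is [m ^+ 2 + (- d)]. *)
Lemma normc_real_add_sqrtc_le0 (R : rcfType) (m d : R) : d <= 0 ->
  ComplexField.Normc.normc (m%:C + sqrtc d%:C)%C = Num.sqrt (m ^+ 2 - d).
Proof.
move=> d_le0; rewrite /= expr0n addr0 sqrtr_sqr ler0_norm // eqxx mul1r.
have -> : (- d - d) / 2 = - d by field.
by rewrite addNr mul0r sqrtr0 addr0 add0r sqr_sqrtr ?oppr_ge0.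
Qed.

Lemma ge_of_quadratic_root (R : realFieldType) (q c r : R) : 0 < q -> q < 1 ->
  let mu := 2 * q / (1 + q ^+ 2) in
  r ^+ 2 - mu * (1 + c) * r + c = 0 -> mu * (1 + c) <= 2 * r -> q <= `|r|.
Proof.
move=> q0 q1 mu eqr le2r; rewrite leNgt.
apply/negP; rewrite ltr_norml => /andP[rq1 rq2].
have q2 : 0 < 1 + q ^+ 2 by nra.
have muE : mu * (1 + q ^+ 2) = 2 * q by rewrite /mu divfK ?gt_eqF.
clearbody mu.
have mu0 : 0 < mu by nra.
have mu1 : mu < 1 by nra.
have mur : 0 < 1 - mu * r by nra.
have key : mu * (1 + r ^+ 2) <= 2 * r.
  (* The root equation reads [c * (1 - mu * r) = r * (mu - r)], so the positive factor [1 - mu * r]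
     eliminates [c] and keeps the sign. *)
  have : 0 <= (2 * r - mu * (1 + c)) * (1 - mu * r).
    by rewrite mulr_ge0 ?subr_ge0 // ltW // -subr_gt0.
  have -> : (2 * r - mu * (1 + c)) * (1 - mu * r) =
    2 * r - mu * (1 + r ^+ 2) - mu * (r ^+ 2 - mu * (1 + c) * r + c) by ring.
  rewrite eqr; lra.
have : 2 * q * (1 + r ^+ 2) <= 2 * r * (1 + q ^+ 2).
  by rewrite -muE mulrAC ler_pM2r.
(* This product equals [q * (1 + r ^+ 2) - r * (1 + q ^+ 2)], which is the monotonicity of
   [2x / (1 + x^2)] with denominators cleared. *)
have : 0 < (q - r) * (1 - q * r) by rewrite mulr_gt0; nra.
lra.
Qed.

(** Times [(1 + q ^+ 2) ^+ 2], the radicand factors as [4 * (q ^+ 2 - c) * (1 - c * q ^+ 2)]; both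
    factors are positive when [c < q ^+ 2]. *)
Lemma ge_of_discriminant_lt0 (R : realFieldType) (q c : R) : 0 < q -> q < 1 ->
  let mu := 2 * q / (1 + q ^+ 2) in
  mu ^+ 2 * (1 + c) ^+ 2 - 4 * c < 0 -> q ^+ 2 <= c.
Proof.
move=> q0 q1 mu d0; rewrite leNgt; apply/negP => cq.
have q2 : 0 < 1 + q ^+ 2 by nra.
have muE : mu * (1 + q ^+ 2) = 2 * q by rewrite /mu divfK ?gt_eqF.
clearbody mu.
have : (mu ^+ 2 * (1 + c) ^+ 2 - 4 * c) * (1 + q ^+ 2) ^+ 2 < 0.
  by rewrite pmulr_llt0 // exprn_gt0.
have -> : (mu ^+ 2 * (1 + c) ^+ 2 - 4 * c) * (1 + q ^+ 2) ^+ 2 =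
  (mu * (1 + q ^+ 2)) ^+ 2 * (1 + c) ^+ 2 - 4 * c * (1 + q ^+ 2) ^+ 2 by ring.
rewrite muE.
have cq2 : c * q ^+ 2 < 1.
  apply: (@lt_trans _ _ (q ^+ 2 * q ^+ 2)); first by rewrite ltr_pM2r ?exprn_gt0.
  by rewrite -exprD exprn_ilt1 ?ltW.
have : 0 < (q ^+ 2 - c) * (1 - c * q ^+ 2) by rewrite mulr_gt0 ?subr_gt0.
lra.
Qed.

Theorem lemma3p5 (R : realType) (kappa : R) (hkappa : 1 < kappa) :
  is_global_minimizer (rbar kappa) (c1star kappa).
Proof.
set s := Num.sqrt kappa.
have s1 : 1 < s by rewrite -sqrtr1 ltr_sqrt //; lra.
have kE : kappa = s ^+ 2 by rewrite sqr_sqrtr //; lra.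
pose q := (s - 1) / (s + 1).
have q0 : 0 < q by rewrite divr_gt0; lra.
have q1 : q < 1 by rewrite ltr_pdivrMr; lra.
have q2 : 0 < 1 + q ^+ 2 by nra.
have muE : mu kappa = 2 * q / (1 + q ^+ 2).
  rewrite /mu kE /q; field; rewrite !gt_eqF //; nra.
have cE : c1star kappa = q ^+ 2 by [].
have rstar : rbar kappa (c1star kappa) = q.
  rewrite /rbar cE muE divfK ?gt_eqF // -exprMn divfK ?gt_eqF //.
  have -> : (2 * q) ^+ 2 - 4 * q ^+ 2 = 0 by ring.
  rewrite normc_real_add_sqrtc_ge0 // sqrtr0 addr0 ger0_norm; lra.
move=> c; rewrite rstar /rbar.
set m := mu kappa * (1 + c); rewrite -exprMn -/m.
have [d0|d0] := leP 0 (m ^+ 2 - 4 * c).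
  rewrite normc_real_add_sqrtc_ge0 //.
  have -> : 1 / 2 * `|m + Num.sqrt (m ^+ 2 - 4 * c)| =
     `|(m + Num.sqrt (m ^+ 2 - 4 * c)) / 2|.
    by rewrite normrM [`|2^-1|]ger0_norm //; lra.
  have := sqrtr_ge0 (m ^+ 2 - 4 * c).
  have := sqr_sqrtr d0.
  set t := Num.sqrt _ => t2 t0.
  (* The root is [r = (m + t) / 2]; being the larger one means [m <= 2 * r], which is [0 <= t]. *)
  apply: (@ge_of_quadratic_root _ q c) => //; rewrite -muE -/m; last by lra.
  have -> : ((m + t) / 2) ^+ 2 - m * ((m + t) / 2) + c =
    (t ^+ 2 - (m ^+ 2 - 4 * c)) / 4 by field.
  by rewrite t2 subrr mul0r.
rewrite normc_real_add_sqrtc_le0; last exact: ltW.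
have qc : q ^+ 2 <= c.
  by apply: ge_of_discriminant_lt0 => //; rewrite -muE -exprMn.
have -> : m ^+ 2 - (m ^+ 2 - 4 * c) = 2 ^+ 2 * c by ring.
rewrite sqrtrM ?sqr_ge0 // sqrtr_sqr ger0_norm //.
have : q <= Num.sqrt c by rewrite -(ger0_norm (ltW q0)) -sqrtr_sqr ler_wsqrtr.
lra.
Qed.
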